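(* Let $[\underline{y},\bar{y}]\subset\mathbb{R}^{2m}$ be a box, and suppose $y^*$ is an optimal solution, with optimal value $v^*_{[\underline{y},\bar{y}]}$, of the problem $$\begin{aligned}\min\quad& y^TA^+y-\big((\bar{y}+\underline{y})^TA^-y-\bar{y}^TA^-\underline{y}\big)+q_0^Ty+c_0\\ \text{s.t.}\quad& y^TB^+y-\big((\bar{y}+\underline{y})^TB^-y-\bar{y}^TB^-\underline{y}\big)+q_1^Ty+c_1\le0,\\ & y^TC^+y-\big((\bar{y}+\underline{y})^TC^-y-\bar{y}^TC^-\underline{y}\big)+q_2^Ty+c_2\le0,\\ & y\in D,\quad y\in[\underline{y},\bar{y}].\end{aligned}$$ Then $$f(y^* )-v^*_{[\underline{y},\bar{y}]}\le\tfrac14\|A^-\|_2\,\|\bar{y}-\underline{y}\|_2^2,\qquad h(y^* )\le\tfrac14\|C^-\|_2\,\|\bar{y}-\underline{y}\|_2^2.$$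
   Context: Data: $m\ge1$; $x_0\in\mathbb{R}^m$ with positive components; diagonal $m\times m$ matrices $\Lambda,\Gamma$ with positive diagonal entries; $p_0\in\mathbb{R}^m$; $l_0,e_0\in\mathbb{R}$ (with $e_0=p_0^Tx_0-l_0$); $\rho_1,\rho_2>0$; $\pi\in(0,1)$; $\delta\ge0$. Write $y=(y_1^T,y_2^T)^T\in\mathbb{R}^{2m}$ with $y_1,y_2\in\mathbb{R}^m$, and (inequalities componentwise) $$D=\{(y_1,y_2): -x_0\le y_1\le 0,\ -x_0\le y_2\le0,\ y_1+y_2\ge -x_0\}.$$ Let $f(y)=y^TQ_0y+q_0^Ty+c_0$, $g(y)=y^TQ_1y+q_1^Ty+c_1$, $h(y)=y^TQ_2y+q_2^Ty+c_2$, where $$Q_0=\begin{bmatrix}\Lambda-\frac{\Gamma}{2}&-\frac{\pi}{2}\Gamma\\-\frac{\pi}{2}\Gamma&\pi(\Lambda-\frac{\Gamma}{2})\end{bmatrix},\ q_0=-\begin{bmatrix}\Gamma x_0\\ \pi\Gamma x_0\end{bmatrix},\ c_0=\pi\delta-e_0,$$ $$Q_1=\begin{bmatrix}\rho_1(\Lambda-\frac{\Gamma}{2})+\Lambda+\frac{\Gamma}{2}&O\\O&O\end{bmatrix},\ q_1=\begin{bmatrix}p_0-\rho_1\Gamma x_0\\0\end{bmatrix},\ c_1=l_0-\rho_1e_0,$$ $$Q_2=\begin{bmatrix}\Lambda+\frac{\Gamma}{2}+\rho_2(\Lambda-\frac{\Gamma}{2})&\frac{1-\rho_2}{2}\Gamma\\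 \frac{1-\rho_2}{2}\Gamma&\Lambda+\frac{\Gamma}{2}+\rho_2(\Lambda-\frac{\Gamma}{2})\end{bmatrix},\ q_2=\begin{bmatrix}p_0-\rho_2\Gamma x_0\\ p_0-\rho_2\Gamma x_0\end{bmatrix},\ c_2=l_0-\rho_2e_0+(\rho_2+1)\delta.$$ For a real symmetric matrix $Q$ with eigenvalues $v_i$ and corresponding orthonormal eigenvectors $w_i$, write $Q=Q^+-Q^-$ with $Q^+=\sum_{v_i\ge0}v_iw_iw_i^T$ and $Q^-=\sum_{v_i<0}|v_i|w_iw_i^T$. Set $A^\pm=Q_0^\pm$, $B^\pm=Q_1^\pm$, $C^\pm=Q_2^\pm$. $\|\cdot\|_2$ is the spectral norm for matrices and the Euclidean norm for vectors; $[\underline{y},\bar{y}]=\{y\in\mathbb{R}^{2m}:\underline{y}\le y\le\bar{y}\}$ componentwise. Standing assumption of the paper: there is a point satisfying all of the constraints $g(y)\le0$, $h(y)\le0$, $y\in D$ strictly, and $\rho_1e_0-l_0<0$. *)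

(* Defs.v *)
(* Mathematical Components, with the classical sets and real numbers of
   MathComp-Analysis. *)
From HB Require Import structures.
From mathcomp Require Import all_boot all_order all_algebra.
From mathcomp Require Import boolp classical_sets reals.

Set Implicit Arguments.
Unset Strict Implicit.
Unset Printing Implicit Defensive.
Import Order.TTheory GRing.Theory Num.Theory.
Local Open Scope classical_set_scope.
Local Open Scope ring_scope.

Definition dot (R : realType) (n : nat) (u v : 'cV[R]_n) : R :=
  (u^T *m v) 0 0.

Definition bilin (R : realType) (n : nat) (u : 'cV[R]_n) (Q : 'M[R]_n)
  (v : 'cV[R]_n) : R := (u^T *m Q *m v) 0 0.

Definition norm2 (R : realType) (n : nat) (u : 'cV[R]_n) : R :=
  Num.sqrt (\sum_i u i 0 ^+ 2).

(* Operator norm induced by [norm2]; the library's norm on matrices is the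
   maximum of the absolute values of the entries. *)
Definition spectral_norm (R : realType) (n : nat) (Q : 'M[R]_n) : R :=
  sup [set norm2 (Q *m x) | x in [set x : 'cV[R]_n | norm2 x <= 1]].

Definition vle (R : realType) (n : nat) (u v : 'cV[R]_n) : Prop :=
  forall i, u i 0 <= v i 0.

Definition vlt (R : realType) (n : nat) (u v : 'cV[R]_n) : Prop :=
  forall i, u i 0 < v i 0.

Definition box (R : realType) (n : nat) (lo hi : 'cV[R]_n) : set 'cV[R]_n :=
  [set y | vle lo y /\ vle y hi].

Definition positive_diag (R : realType) (n : nat) (M : 'M[R]_n) : Prop :=
  is_diag_mx M /\ forall i, 0 < M i i.

(* [Qp] and [Qm] are the parts of [Q] carried by its nonnegative and negative
   eigenvalues; neither depends on the chosen orthonormal eigenbasis, so the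
   relation determines them. *)
Definition spectral_split (R : realType) (n : nat) (Q Qp Qm : 'M[R]_n) : Prop :=
  exists (v : 'I_n -> R) (w : 'I_n -> 'cV[R]_n),
    [/\ forall i, Q *m w i = v i *: w i,
        forall i j, dot (w i) (w j) = (i == j)%:R,
        Qp = \sum_(i | 0 <= v i) v i *: (w i *m (w i)^T)
      & Qm = \sum_(i | v i < 0) `|v i| *: (w i *m (w i)^T)].

Definition quadratic (R : realType) (n : nat) (Q : 'M[R]_n) (q : 'cV[R]_n)
  (c : R) (y : 'cV[R]_n) : R := bilin y Q y + dot q y + c.

Definition relaxed (R : realType) (n : nat) (Qp Qm : 'M[R]_n) (q : 'cV[R]_n)
  (c : R) (lo hi y : 'cV[R]_n) : R :=
  bilin y Qp y - (bilin (hi + lo) Qm y - bilin hi Qm lo) + dot q y + c.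

Definition is_optimal_solution (T : Type) (R : realType) (obj : T -> R)
  (feasible : set T) (y : T) : Prop :=
  feasible y /\ forall z, feasible z -> obj y <= obj z.

Definition optimal_value (T : Type) (R : realType) (obj : T -> R)
  (feasible : set T) : R := inf [set obj y | y in feasible].

Definition Dset (R : realType) (m : nat) (x0 : 'cV[R]_m) :
    set 'cV[R]_(m + m) :=
  [set y | [/\ vle (- x0) (usubmx y) /\ vle (usubmx y) 0,
               vle (- x0) (dsubmx y) /\ vle (dsubmx y) 0
             & vle (- x0) (usubmx y + dsubmx y)]].

Definition Dset_strict (R : realType) (m : nat) (x0 : 'cV[R]_m) :
    set 'cV[R]_(m + m) :=
  [set y | [/\ vlt (- x0) (usubmx y) /\ vlt (usubmx y) 0,
               vlt (- x0) (dsubmx y) /\ vlt (dsubmx y) 0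
             & vlt (- x0) (usubmx y + dsubmx y)]].

Definition Q0 (R : realType) (m : nat) (Lambda Gamma : 'M[R]_m) (pi : R) :
    'M[R]_(m + m) :=
  block_mx (Lambda - 2^-1 *: Gamma) (- (pi / 2) *: Gamma)
           (- (pi / 2) *: Gamma) (pi *: (Lambda - 2^-1 *: Gamma)).

Definition q0 (R : realType) (m : nat) (Gamma : 'M[R]_m) (x0 : 'cV[R]_m)
    (pi : R) : 'cV[R]_(m + m) :=
  - col_mx (Gamma *m x0) (pi *: (Gamma *m x0)).

Definition c0 (R : realType) (pi delta e0 : R) : R := pi * delta - e0.

Definition Q1 (R : realType) (m : nat) (Lambda Gamma : 'M[R]_m) (rho1 : R) :
    'M[R]_(m + m) :=
  block_mx (rho1 *: (Lambda - 2^-1 *: Gamma) + Lambda + 2^-1 *: Gamma) 0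
           0 0.

Definition q1 (R : realType) (m : nat) (Gamma : 'M[R]_m) (x0 p0 : 'cV[R]_m)
    (rho1 : R) : 'cV[R]_(m + m) :=
  col_mx (p0 - rho1 *: (Gamma *m x0)) 0.

Definition c1 (R : realType) (rho1 l0 e0 : R) : R := l0 - rho1 * e0.

Definition Q2 (R : realType) (m : nat) (Lambda Gamma : 'M[R]_m) (rho2 : R) :
    'M[R]_(m + m) :=
  block_mx
    (Lambda + 2^-1 *: Gamma + rho2 *: (Lambda - 2^-1 *: Gamma))
    (((1 - rho2) / 2) *: Gamma)
    (((1 - rho2) / 2) *: Gamma)
    (Lambda + 2^-1 *: Gamma + rho2 *: (Lambda - 2^-1 *: Gamma)).

Definition q2 (R : realType) (m : nat) (Gamma : 'M[R]_m) (x0 p0 : 'cV[R]_m)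
    (rho2 : R) : 'cV[R]_(m + m) :=
  col_mx (p0 - rho2 *: (Gamma *m x0)) (p0 - rho2 *: (Gamma *m x0)).

Definition c2 (R : realType) (rho2 delta l0 e0 : R) : R :=
  l0 - rho2 * e0 + (rho2 + 1) * delta.

Definition relaxed_feasible (R : realType) (m : nat) (x0 : 'cV[R]_m)
    (Bp Bm : 'M[R]_(m + m)) (q1 : 'cV[R]_(m + m)) (c1 : R)
    (Cp Cm : 'M[R]_(m + m)) (q2 : 'cV[R]_(m + m)) (c2 : R)
    (lo hi : 'cV[R]_(m + m)) : set 'cV[R]_(m + m) :=
  [set y | [/\ relaxed Bp Bm q1 c1 lo hi y <= 0,
               relaxed Cp Cm q2 c2 lo hi y <= 0,
               Dset x0 y
             & box lo hi y]].

(* Main.v *)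
(* Since [Q = Qp - Qm] with [Qm] symmetric, replacing [- y^T Qm y] by its
   linear underestimator costs [(hi - y)^T Qm (y - lo)]; with
   [u = hi - y], [v = y - lo] and [Qm] positive semidefinite, the polarization
   identity [4 u^T Qm v = (u + v)^T Qm (u + v) - (u - v)^T Qm (u - v)] bounds
   this gap by [1/4 (hi - lo)^T Qm (hi - lo)], and Cauchy-Schwarz concludes. *)
Require Import Defs.
From HB Require Import structures.
From mathcomp Require Import all_boot all_order all_algebra.
From mathcomp Require Import boolp classical_sets reals.
From mathcomp Require Import ring lra.
Set Implicit Arguments.
Unset Strict Implicit.
Unset Printing Implicit Defensive.
Import Order.TTheory GRing.Theory Num.Theory.
Local Open Scope classical_set_scope.
Local Open Scope ring_scope.


Section EuclideanVectors.
Variables (R : realType) (n : nat).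
Implicit Types (u v x : 'cV[R]_n) (Q : 'M[R]_n).

Lemma dotE u v : dot u v = \sum_i u i 0 * v i 0.
Proof. by rewrite /dot mxE; apply: eq_bigr => i _; rewrite mxE. Qed.

Lemma dotC u v : dot u v = dot v u.
Proof. by rewrite !dotE; apply: eq_bigr => i _; rewrite mulrC. Qed.

Lemma dotxx_ge0 u : 0 <= dot u u.
Proof. by rewrite dotE sumr_ge0 // => i _; rewrite -expr2 sqr_ge0. Qed.

Lemma bilin_dot u Q v : bilin u Q v = dot u (Q *m v).
Proof. by rewrite /bilin /dot mulmxA. Qed.

Lemma bilinDl u v Q x : bilin (u + v) Q x = bilin u Q x + bilin v Q x.
Proof. by rewrite /bilin linearD !mulmxDl mxE. Qed.

Lemma bilinNl u Q x : bilin (- u) Q x = - bilin u Q x.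
Proof. by rewrite /bilin linearN !mulNmx mxE. Qed.

Lemma bilinDr x Q u v : bilin x Q (u + v) = bilin x Q u + bilin x Q v.
Proof. by rewrite /bilin mulmxDr mxE. Qed.

Lemma bilinNr x Q u : bilin x Q (- u) = - bilin x Q u.
Proof. by rewrite /bilin mulmxN mxE. Qed.

Lemma bilinB u (P Q : 'M[R]_n) v :
  bilin u (P - Q) v = bilin u P v - bilin u Q v.
Proof. by rewrite /bilin mulmxBr mulmxBl !mxE. Qed.

Lemma bilin_sym u Q v : Q^T = Q -> bilin u Q v = bilin v Q u.
Proof.
by move=> Qsym; rewrite !bilin_dot dotC /dot trmx_mul Qsym -mulmxA.
Qed.

Lemma norm2_ge0 u : 0 <= norm2 u. Proof. exact: sqrtr_ge0. Qed.

Lemma norm2_sqr u : norm2 u ^+ 2 = dot u u.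
Proof.
rewrite /norm2 sqr_sqrtr; last by apply: sumr_ge0 => i _; exact: sqr_ge0.
by rewrite dotE; apply: eq_bigr => i _; rewrite expr2.
Qed.

Lemma norm2_eq0 u : norm2 u = 0 -> u = 0.
Proof.
move=> u0; have : dot u u = 0 by rewrite -norm2_sqr u0 expr0n.
rewrite dotE => /eqP; rewrite psumr_eq0 => [/allP uu0|i _]; last first.
  by rewrite -expr2 sqr_ge0.
apply/matrixP => i j; rewrite ord1 mxE.
by have := uu0 i (mem_index_enum _); rewrite /= mulf_eq0 orbb => /eqP.
Qed.

Lemma norm2Z a u : 0 <= a -> norm2 (a *: u) = a * norm2 u.
Proof.
move=> a0; rewrite /norm2 -[X in X * _](ger0_norm a0) -sqrtr_sqr -sqrtrM ?sqr_ge0//.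
by rewrite mulr_sumr; congr Num.sqrt; apply: eq_bigr => i _; rewrite mxE exprMn.
Qed.

(** Cauchy-Schwarz: with [a = norm2 u] and [b = norm2 v], the squared length of [b *: u - a *: v] is
    [2 * (a * b) * (a * b - dot u v)], and it is nonnegative. Zero vectors are treated apart so that
    [a * b] can be cancelled. *)
Lemma dot_le_norm2 u v : dot u v <= norm2 u * norm2 v.
Proof.
have [u0|u0] := eqVneq (norm2 u) 0.
  by rewrite u0 mul0r (norm2_eq0 u0) /dot trmx0 mul0mx mxE.
have [v0|v0] := eqVneq (norm2 v) 0.
  by rewrite v0 mulr0 (norm2_eq0 v0) /dot mulmx0 mxE.
set a := norm2 u; set b := norm2 v.
have ab0 : 0 < a * b by rewrite mulr_gt0 // lt0r ?u0 ?v0 norm2_ge0.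
have := dotxx_ge0 (b *: u - a *: v).
have -> : dot (b *: u - a *: v) (b *: u - a *: v) =
    b ^+ 2 * dot u u - 2 * (a * b) * dot u v + a ^+ 2 * dot v v.
  rewrite !dotE !mulr_sumr -sumrB -big_split /=; apply: eq_bigr => i _.
  by rewrite !mxE; ring.
rewrite -!norm2_sqr -/a -/b => ge0.
rewrite -(ler_pM2l ab0); lra.
Qed.

(** Without this, [sup] need not be an upper bound. On the unit ball every coordinate of [x] is at
    most 1 in absolute value, so each coordinate of [Q *m x] is bounded by an absolute row sum of
    [Q]; the norm of the vector of row sums is the bound. *)
Lemma spectral_norm_has_sup Q :
  has_sup [set norm2 (Q *m x) | x in [set x : 'cV[R]_n | norm2 x <= 1]].
Proof.
split.
  exists (norm2 (Q *m 0)), 0 => //=.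
  by rewrite /norm2 big1 ?sqrtr0 ?ler01 // => i _; rewrite mxE expr0n.
exists (Num.sqrt (\sum_i (\sum_j `|Q i j|) ^+ 2)) => _ [x /= x1 <-].
have coord_le1 j : `|x j 0| <= 1.
  apply: le_trans x1; rewrite /norm2 -sqrtr_sqr ler_wsqrtr //.
  rewrite (bigD1 j) //= lerDl; apply: sumr_ge0 => i _; exact: sqr_ge0.
apply: ler_wsqrtr; apply: ler_sum => i _; rewrite -real_normK ?num_real //.
rewrite lerXn2r ?nnegrE ?sumr_ge0 // mxE; apply: le_trans (ler_norm_sum _ _ _) _.
by apply: ler_sum => j _; rewrite normrM ler_piMr.
Qed.

(** Rescaling a nonzero [x] to unit length puts it in the set whose supremum is
    [spectral_norm Q]. *)
Lemma norm2_mulmx_le Q x : norm2 (Q *m x) <= spectral_norm Q * norm2 x.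
Proof.
have [x0|x0] := eqVneq (norm2 x) 0.
  rewrite x0 mulr0 (norm2_eq0 x0) mulmx0 /norm2 big1 ?sqrtr0 // => i _.
  by rewrite mxE expr0n.
have xgt0 : 0 < norm2 x by rewrite lt0r x0 norm2_ge0.
have xV_ge0 : 0 <= (norm2 x)^-1 by rewrite invr_ge0 norm2_ge0.
rewrite -ler_pdivrMr // mulrC -norm2Z // scalemxAr.
apply: (sup_upper_bound (spectral_norm_has_sup Q)).
by exists ((norm2 x)^-1 *: x); rewrite //= norm2Z // mulVf.
Qed.

Lemma bilin_le_spectral_norm Q x :
  bilin x Q x <= spectral_norm Q * norm2 x ^+ 2.
Proof.
rewrite bilin_dot; apply: le_trans (dot_le_norm2 _ _) _.
by rewrite expr2 mulrA [leRHS]mulrC ler_wpM2l ?norm2_ge0 ?norm2_mulmx_le.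
Qed.

(** Orthonormality says [W^T *m W = 1%:M] for the matrix [W] with columns [w i]. As [W] is square,
    also [W *m W^T = 1%:M], and this product is the sum of the outer products. *)
Lemma orthonormal_sum_outer (w : 'I_n -> 'cV[R]_n) :
  (forall i j, dot (w i) (w j) = (i == j)%:R) ->
  \sum_i w i *m (w i)^T = 1%:M.
Proof.
move=> w_on; pose W := \matrix_(i, j) w j i 0.
have : W^T *m W = 1%:M.
  apply/matrixP => i j; rewrite !mxE -w_on dotE.
  by apply: eq_bigr => k _; rewrite !mxE.
move=> /mulmx1C <-; apply/matrixP => i j; rewrite summxE mxE.
by apply: eq_bigr => k _; rewrite !mxE big_ord1 !mxE.
Qed.

(** Multiplying [Q] by the resolution of the identity gives the sum of [v i *: (w i *m (w i)^T)],
    which is then split by the sign of [v i]. *)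
Lemma spectral_splitB Q Qp Qm : spectral_split Q Qp Qm -> Qp - Qm = Q.
Proof.
case=> v [w [Qw w_on -> ->]].
rewrite -[RHS]mulmx1 -(orthonormal_sum_outer w_on) mulmx_sumr.
rewrite [RHS](bigID (fun i => 0 <= v i)) /= -sumrN; congr (_ + _).
  by apply: eq_bigr => i _; rewrite mulmxA Qw scalemxAl.
apply: eq_big => [i|i vi]; first by rewrite ltNge.
by rewrite ltr0_norm // scaleNr opprK mulmxA Qw scalemxAl.
Qed.

Lemma spectral_split_sym Q Qp Qm : spectral_split Q Qp Qm -> Qm^T = Qm.
Proof.
case=> v [w [_ _ _ ->]]; rewrite linear_sum; apply: eq_bigr => i _ /=.
by rewrite linearZ /= trmx_mul trmxK.
Qed.

(** The form is a sum of terms [|v i|] times the square of [dot x (w i)]. *)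
Lemma spectral_split_psd Q Qp Qm x :
  spectral_split Q Qp Qm -> 0 <= bilin x Qm x.
Proof.
case=> v [w [_ _ _ ->]]; rewrite /bilin mulmx_sumr mulmx_suml summxE.
apply: sumr_ge0 => i _; rewrite -scalemxAr -scalemxAl mxE mulr_ge0 //.
(* Regrouped as a product of two 1 by 1 matrices, each of them a dot product. *)
rewrite mulmxA -(mulmxA _ (w i)^T) mxE big_ord1 -/(dot x (w i)) -/(dot (w i) x) dotC.
by rewrite -expr2 sqr_ge0.
Qed.

Lemma quadratic_relaxedB_le Q Qp Qm (q : 'cV[R]_n) (c : R) (lo hi y : 'cV[R]_n) :
  spectral_split Q Qp Qm ->
  quadratic Q q c y - relaxed Qp Qm q c lo hi y
    <= 4^-1 * spectral_norm Qm * norm2 (hi - lo) ^+ 2.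
Proof.
move=> split; have Qm_sym := spectral_split_sym split.
(* This vector is [u - v] for [u = hi - y] and [v = y - lo]: its form is the term dropped from the
   polarization identity. *)
have psd := spectral_split_psd (hi + lo - (y + y)) split.
have := bilin_le_spectral_norm Qm (hi - lo).
rewrite /quadratic /relaxed -(spectral_splitB split) bilinB.
move: psd; rewrite !(bilinDl, bilinDr, bilinNl, bilinNr).
(* Each cross term is brought to a single order of its arguments, so that the rest is linear
   arithmetic in the values of [bilin]. *)
rewrite (bilin_sym lo hi Qm_sym) (bilin_sym y hi Qm_sym).
rewrite (bilin_sym y lo Qm_sym); lra.
Qed.

End EuclideanVectors.

(** Optimality makes [obj y] a lower bound of the attained values, and [y] itself shows that there
    are some, so the infimum is not below [obj y]. *)
Lemma optimal_value_ge (T : Type) (R : realType) (obj : T -> R)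
    (feasible : set T) (y : T) :
  is_optimal_solution obj feasible y -> obj y <= optimal_value obj feasible.
Proof.
case=> y_feas y_min; apply: lb_le_inf; first by exists (obj y), y.
by move=> _ [z z_feas <-]; exact: y_min.
Qed.

Theorem theorem3p2 (R : realType) (m : nat) (hm : (1 <= m)%N)
  (x0 : 'cV[R]_m) (hx0 : vlt 0 x0)
  (Lambda Gamma : 'M[R]_m)
  (hLambda : positive_diag Lambda) (hGamma : positive_diag Gamma)
  (p0 : 'cV[R]_m) (l0 e0 : R) (he0 : e0 = dot p0 x0 - l0)
  (rho1 rho2 : R) (hrho1 : 0 < rho1) (hrho2 : 0 < rho2)
  (pi : R) (hpi0 : 0 < pi) (hpi1 : pi < 1)
  (delta : R) (hdelta : 0 <= delta)
  (f g h : 'cV[R]_(m + m) -> R)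
  (hf : f = quadratic (Q0 Lambda Gamma pi) (q0 Gamma x0 pi) (c0 pi delta e0))
  (hg : g = quadratic (Q1 Lambda Gamma rho1) (q1 Gamma x0 p0 rho1)
              (c1 rho1 l0 e0))
  (hh : h = quadratic (Q2 Lambda Gamma rho2) (q2 Gamma x0 p0 rho2)
              (c2 rho2 delta l0 e0))
  (hslater : exists y, [/\ g y < 0, h y < 0 & Dset_strict x0 y])
  (hneg : rho1 * e0 - l0 < 0)
  (Ap Am Bp Bm Cp Cm : 'M[R]_(m + m))
  (hA : spectral_split (Q0 Lambda Gamma pi) Ap Am)
  (hB : spectral_split (Q1 Lambda Gamma rho1) Bp Bm)
  (hC : spectral_split (Q2 Lambda Gamma rho2) Cp Cm)
  (lo hi : 'cV[R]_(m + m))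
  (objective : 'cV[R]_(m + m) -> R)
  (hobjective : objective =
     relaxed Ap Am (q0 Gamma x0 pi) (c0 pi delta e0) lo hi)
  (feasible : set 'cV[R]_(m + m))
  (hfeasible : feasible =
     relaxed_feasible x0
       Bp Bm (q1 Gamma x0 p0 rho1) (c1 rho1 l0 e0)
       Cp Cm (q2 Gamma x0 p0 rho2) (c2 rho2 delta l0 e0) lo hi)
  (ystar : 'cV[R]_(m + m))
  (hystar : is_optimal_solution objective feasible ystar) :
  f ystar - optimal_value objective feasible
    <= 4^-1 * spectral_norm Am * norm2 (hi - lo) ^+ 2 /\
  h ystar <= 4^-1 * spectral_norm Cm * norm2 (hi - lo) ^+ 2.
Proof.
have [ystar_feas _] := hystar; split.
  have := quadratic_relaxedB_le (q0 Gamma x0 pi) (c0 pi delta e0) lo hi ystar hA.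
  rewrite -hf -hobjective; apply: le_trans.
  (* Replacing the optimal value by the smaller or equal [objective ystar] can only increase the
     difference. *)
  by rewrite lerD2l lerN2 optimal_value_ge.
have := quadratic_relaxedB_le (q2 Gamma x0 p0 rho2) (c2 rho2 delta l0 e0)
  lo hi ystar hC.
rewrite -hh; apply: le_trans.
(* The relaxed constraint is nonpositive at [ystar], so [h ystar] is at most the relaxation gap
   there. *)
move: ystar_feas; rewrite hfeasible => -[_ relaxed_le0 _ _].
by rewrite lerBrDl gerDr.
Qed.
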